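(* Let $G\rightrightarrows G_0$ be a groupoid object in $\mathrm{Pyk}(\mathcal{S})$, with space of arrows $G_1$, such that the source and target maps $s,t:G_1\to G_0$ are open maps. Assume $G_1$ is locally profinite and $G_0$ is profinite. Then for every open neighborhood $U$ of $G_0$ in $G_1$, there exists a Hausdorff compact open subgroupoid $H\subseteq G$ such that $$G_0\subseteq H_1\subseteq U.$$ (In particular, $H$ is wide in the sense that it contains all units.)
   Context: $\mathrm{Pyk}(\mathcal{S})$ is the $\infty$-topos of pyknotic spaces (hypercomplete sheaves of spaces on profinite sets for the topology of finite jointly surjective families). Here the objects $G_0$ and $G_1$ are topological spaces (viewed as pyknotic spaces), so that $G$ is a topological groupoid: $G_0$ is the space of objects, $G_1$ the space of arrows, and source, target, unit, inversion and multiplication are continuous. $G_0$ is regarded as a subset of $G_1$ via the unit map. A profinite space is a compact Hausdorff totally disconnected space. A topological space is locally profinite if every point has a profinite neighborhood (such a space is not assumed to be Hausdorff). A Hausdorff compact open subgroupoid $H\subseteq G$ is given by a subset $H_1\subseteq G_1$ closed under multiplication of composable arrows and under inversion, containing the units of its objects, such that $H_1$ is open in $G_1$, and compact and Hausdorff in the subspace topology. *)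

(* Defs.v *)
From mathcomp Require Import all_boot all_order all_algebra.
From mathcomp Require Import all_classical all_reals all_analysis.

Set Implicit Arguments.
Unset Strict Implicit.
Unset Printing Implicit Defensive.

Local Open Scope classical_set_scope.

Definition profinite (T : topologicalType) : Prop :=
  [/\ compact [set: T], hausdorff_space T & totally_disconnected [set: T]].

(* Neighborhoods need not be open; N carries the subspace topology, i.e. the
   canonical topology on the subtype set_type N.  The space T itself is not
   required to be Hausdorff. *)
Definition locally_profinite (T : topologicalType) : Prop :=
  forall x : T, exists2 N : set T, nbhs x N & profinite (set_type N).

Definition open_map (S T : topologicalType) (f : S -> T) : Prop :=
  forall A : set S, open A -> open (f @` A).

(* [mul g h] is the composite of h followed by g.  It is only meaningful when
   [src g = tgt h]: its values on non-composable pairs are junk, no axiom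
   constrains them, and continuity is only required for the subspace topology
   on the set of composable pairs, i.e. on the fibre product of arr with itself
   over obj. *)
Record topGroupoid := TopGroupoid {
  obj : topologicalType;
  arr : topologicalType;
  src : arr -> obj;
  tgt : arr -> obj;
  idarr : obj -> arr;
  inv : arr -> arr;
  mul : arr -> arr -> arr;
  src_continuous : continuous src;
  tgt_continuous : continuous tgt;
  idarr_continuous : continuous idarr;
  inv_continuous : continuous inv;
  mul_continuous :
    {within [set p : arr * arr | src p.1 = tgt p.2],
      continuous (fun p : arr * arr => mul p.1 p.2)};
  src_idarr : forall x, src (idarr x) = x;
  tgt_idarr : forall x, tgt (idarr x) = x;
  src_mul : forall g h, src g = tgt h -> src (mul g h) = src h;
  tgt_mul : forall g h, src g = tgt h -> tgt (mul g h) = tgt g;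
  mul_assoc : forall g h k, src g = tgt h -> src h = tgt k ->
    mul g (mul h k) = mul (mul g h) k;
  mul_idarr : forall g, mul g (idarr (src g)) = g;
  idarr_mul : forall g, mul (idarr (tgt g)) g = g;
  src_inv : forall g, src (inv g) = tgt g;
  tgt_inv : forall g, tgt (inv g) = src g;
  mul_inv : forall g, mul g (inv g) = idarr (tgt g);
  inv_mul : forall g, mul (inv g) g = idarr (src g)
}.

Arguments src {t} _.
Arguments tgt {t} _.
Arguments idarr {t} _.
Arguments inv {t} _.
Arguments mul {t} _ _.

Record subgroupoid (G : topGroupoid) (H1 : set (arr G)) : Prop := {
  subgroupoid_mul :
    forall g h, H1 g -> H1 h -> src g = tgt h -> H1 (mul g h);
  subgroupoid_inv : forall g, H1 g -> H1 (inv g);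
  subgroupoid_src : forall g, H1 g -> H1 (idarr (src g));
  subgroupoid_tgt : forall g, H1 g -> H1 (idarr (tgt g))
}.

Definition hausdorff_compact_open_subgroupoid
    (G : topGroupoid) (H1 : set (arr G)) : Prop :=
  [/\ subgroupoid H1, open H1, compact H1 & hausdorff_space (set_type H1)].

(* Main.v *)
Require Import Defs.
From mathcomp Require Import all_boot all_order all_algebra.
From mathcomp Require Import all_classical all_reals all_analysis.
Import Defs.
Local Open Scope classical_set_scope.

(** The argument adapts the proof that the compact open subgroups of a profinite
    group form a neighborhood basis of the identity.

    Let W be a compact open set of arrows containing the units, and let M be
    the set of arrows g such that right translation by g maps W into W, i.e.
    w g is in W whenever w is in W and w g is defined ([stabilizer]).
    Then M contains the units and is closed under composition, so the arrows
    which lie in M together with their inverse form a subgroupoid H; and M is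
    contained in W, because W contains the units.  By the tube lemma, applied
    to the compact set W, M is open ([stabilizer_open]).

    Compactness of H is the point at which a non-Hausdorff space of arrows is a
    difficulty.  If g is in W but not in M, some product w g lies outside W,
    and one would like w' g' to stay outside W for g' near g and a suitable w'
    near w; such a w' exists because the source map is open.  But w g may be in
    the closure of W.  This cannot happen if W . W lies in a set K in
    which points have disjoint neighborhoods, for then the compact set W is
    closed in K.  With this, M is closed in W, hence compact
    ([stabilizer_relatively_closed]); if K also contains the inverses of the
    elements of W, the same reasoning shows that H is closed in M, hence compact
    ([hausdorff_compact_open_stabilizer]).

    It remains to find W inside the given neighborhood U and K.  Locally this is
    easy: every unit has a compact open neighborhood C inside U such that
    C . C and the inverses of C lie in a set N whose points are separated
    ([unit_compact_open_nbhs]).  These local choices are patched along a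
    partition of the profinite space of objects into clopen pieces, each piece
    X_i carrying one pair C_i, N_i: one takes for W the union over i of the
    arrows of C_i with both ends in X_i, and similarly for K with N_i
    ([glue]).  Requiring both ends to lie in the same piece means that
    two arrows of W can only be composed if they come from the same C_i, so that
    W . W lies in K; and the points of K are separated, those with different
    sources by their sources and the others within one N_i. *)

(** * Relatively Hausdorff sets and compactness *)

(** Points of [K] are separated by neighborhoods in the ambient space, which
    avoids moving between [T] and the subspace [K].  For an open [K] this
    amounts to [K] being a Hausdorff space. *)
Definition hausdorff_on {T : topologicalType} (K : set T) : Prop :=
  forall p q, K p -> K q -> cluster (nbhs p) q -> p = q.

Lemma hausdorff_on_sub {T : topologicalType} (H K : set T) :
  H `<=` K -> hausdorff_on K -> hausdorff_on H.
Proof. by move=> HK hK p q /HK Kp /HK Kq; exact: hK. Qed.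

Lemma cluster_continuous {S T : topologicalType} (f : S -> T) (p q : S) :
  continuous f -> cluster (nbhs p) q -> cluster (nbhs (f p)) (f q).
Proof.
move=> cf pq A B /(cf p) Ap /(cf q) Bq.
by have [z [Az Bz]] := pq _ _ Ap Bq; exists (f z).
Qed.

Lemma hausdorff_on_set_type {T : topologicalType} (K : set T) :
  hausdorff_on K -> hausdorff_space (set_type K).
Proof.
move=> hK p q pq; apply: val_inj; apply: hK; try exact: set_valP.
exact: (cluster_continuous set_val p q (@initial_continuous _ _ _) pq).
Qed.

Lemma interior_hausdorff_on {T : topologicalType} (N : set T) :
  hausdorff_space (set_type N) -> hausdorff_on N°.
Proof.
move=> hN p q Np Nq pq.
have inN z : N° z -> z \in N by move=> /interior_subset/mem_set.
suff: exist _ p (inN p Np) = exist _ q (inN q Nq) :> set_type N by case.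
apply: hN => A0 B0 [_ [[A oA <-] Ap subA]] [_ [[B oB <-] Bq subB]].
have [z [[Az Nz] Bz]] : (A `&` N°) `&` B !=set0.
  apply: pq; last exact: open_nbhs_nbhs.
  by apply: open_nbhs_nbhs; split=> //; apply: openI => //; exact: open_interior.
by exists (exist _ z (inN z Nz)); split; [exact: subA|exact: subB].
Qed.

(** The relative version of the closedness of compact sets in a Hausdorff
    space: the space [T] need not be Hausdorff, only [K]. *)
Lemma compact_closed_in {T : topologicalType} {K W : set T} {y : T} :
  hausdorff_on K -> compact W -> W `<=` K -> K y -> ~ W y -> nbhs y (~` W).
Proof.
move=> hK cW WK Ky nWy; apply: contrapT => nyW.
have clWy : closure W y.
  move=> B By; apply: contrapT => /nonemptyPn/disjoints_subset WB.
  by apply: nyW; apply: filterS By => z Bz Wz; exact: WB Bz.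
have PW := @within_nbhs_proper _ W y clWy.
have [p [Wp yp]] := cW _ PW (withinT W (nbhs_filter y)).
apply: nWy; rewrite (hK y p) //; first exact: WK.
by apply: cvg_cluster yp; exact: cvg_within.
Qed.

Lemma compact_relatively_closed {T : topologicalType} {A B : set T} :
  compact B -> A `<=` B -> (forall p, B p -> ~ A p -> nbhs p (~` A)) ->
  compact A.
Proof.
move=> cB AB clA F PF FA.
have [p [Bp Fp]] := cB F PF (filterS AB FA).
exists p; split=> //; apply: contrapT => /(clA p Bp) nA.
by have [z []] := Fp _ _ FA nA.
Qed.

(** Compactness is local over a compact base: along an ultrafilter on [W] the
    images converge to some [x] in [X], so the ultrafilter lives on the part of
    [W] over a neighborhood of [x]. *)
Lemma compact_preimage_local {T X : topologicalType} (f : T -> X) (W : set T) :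
  compact [set: X] ->
  (forall x : X, exists2 V, nbhs x V & compact (W `&` f @^-1` V)) -> compact W.
Proof.
move=> cX locW; rewrite compact_ultra => F UF FW.
have [x [_ Fx]] := cX (f @ F) _ filterT.
have [V xV] := locW x; rewrite compact_ultra => cV.
have [|z [[Wz _] Fz]] := cV F UF; last by exists z.
apply: filterI => //.
have [//|FnV] := in_ultra_setVsetC (f @^-1` V) UF.
by have [z []] := Fx (~` V) V FnV xV.
Qed.

Lemma compact_finite_cover {X : topologicalType} (B : X -> set X) :
  compact [set: X] -> (forall x, nbhs x (B x)) ->
  exists s : seq X, forall y, exists2 x, x \in s & B x y.
Proof.
move=> cX nB.
(* The filter of the finite lists of points, ordered by inclusion. *)
pose F :=
  filter_from setT (fun s : seq X => [set r : seq X | {subset s <= r}]).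
have PF : ProperFilter F.
  apply: filter_from_proper; last by move=> s _; exists s.
  apply: filter_from_filter; first by exists [::].
  move=> s r _ _; exists (s ++ r) => // u sru.
  by split=> z zs; apply: sru; rewrite mem_cat zs ?orbT.
have /compact_near_coveringP/(_ _ F (fun s y => exists2 x, x \in s & B x y)) :=
  cX.
case.
  move=> x _; exists (B x, [set r : seq X | x \in r]) => /=.
    by split=> //; exists [:: x] => // r; apply; rewrite inE.
  by case=> y r /= [Bxy xr]; exists x.
by move=> s _ /(_ s (fun _ => id)) sP; exists s => y; exact: sP.
Qed.

(** * Clopen sets in profinite spaces *)

(** In a compact Hausdorff space, the intersection [Q] of the clopen sets around
    [x] (its quasi-component) is connected, hence equal to the connected
    component of [x].  Indeed, if [Q] were the disjoint union of closed sets [A]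
    (containing [x]) and [B], normality would give a neighborhood [V] of [A]
    with closure away from [B]; the boundary of [V] is compact and misses [Q],
    so a single clopen set [C] around [x] misses it, and [C `&` V] is then a
    clopen set around [x] which misses [B] (here [V] stands for its interior or
    its closure, which agree on [C]). *)
Lemma profinite_zero_dimensional {X : topologicalType} :
  profinite X -> zero_dimensional X.
Proof.
case=> cX hX tdX x y; apply: contra_neqP => noclopen.
pose Q := [set z | forall C, clopen C -> C x -> C z].
have Qx : Q x by [].
have Qy : Q y.
  by move=> C cC Cx; apply: contrapT => nCy; apply: noclopen; exists C.
have clQ : closed Q.
  move=> z clz C [oC cC] Cx; apply: (cC) => V /clz[u [Qu Vu]].
  by exists u; split=> //; exact: (Qu C (conj oC cC) Cx).
have noSplit A B : closed A -> closed B -> Q `<=` A `|` B ->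
    A `&` B = set0 -> A x -> Q `&` B = set0.
  move=> clA clB QAB AB0 Ax.
  have [|V AV VB] := @compact_normal _ hX cX A clA (~` B).
    move=> z Az; apply: open_nbhs_nbhs; split; first exact: closed_openC.
    by move=> Bz; have : (A `&` B) z by []; rewrite AB0.
  pose bdV := closure V `\` V°.
  have [C [[oC cC] Cx CV0]] : exists C, [/\ clopen C, C x & C `&` bdV = set0].
    apply: contrapT => noC.
    have cbdV : compact bdV.
      apply: subclosed_compact cX _ => //; apply: closedI.
        exact: closed_closure.
      by apply: open_closedC; exact: open_interior.
    pose F := filter_from [set C | clopen C /\ C x] (fun C => C `&` bdV).
    have PF : ProperFilter F.
      apply: filter_from_proper.
        apply: filter_from_filter.
          by exists setT; split=> //; exact: clopenT.
        move=> C D [cC Cx] [cD Dx]; exists (C `&` D).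
          by split=> //; exact: clopenI.
        by move=> z [[Cz Dz] Kz].
      move=> C [cC Cx]; apply/set0P/negP => /eqP C0.
      by apply: noC; exists C.
    have [|k [[clVk nVk] Fk]] := cbdV F PF.
      by exists setT; [split=> //; exact: clopenT|move=> z []].
    apply: nVk.
    have Qk : Q k.
      move=> C [oC cC] Cx; apply: contrapT => nCk.
      have FC : F (C `&` bdV) by exists C.
      have [|z [[Cz _]]] := Fk _ (~` C) FC; last by [].
      by apply: open_nbhs_nbhs; split=> //; exact: closed_openC.
    have [Ak|Bk] := QAB _ Qk; first exact: AV.
    by have := VB _ clVk.
  have CV : C `&` V° = C `&` closure V.
    rewrite eqEsubset; split=> z [Cz Vz]; split=> //.
      by apply: subset_closure; exact: interior_subset.
    by apply: contrapT => nVz; have : (C `&` bdV) z by []; rewrite CV0.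
  rewrite -subset0 => z [Qz Bz].
  suff [_ clVz] : (C `&` closure V) z by exact: VB clVz Bz.
  rewrite -CV; apply: Qz; last by split=> //; exact: AV.
  split; first by apply: openI => //; exact: open_interior.
  by rewrite CV; apply: closedI => //; exact: closed_closure.
have conQ : connected Q.
  move=> B [b Bb] [C oC BC] [D cD BD].
  have clB : closed B by rewrite BD; exact: closedI.
  have clQC : closed (Q `&` ~` C) by apply: closedI => //; exact: open_closedC.
  have QE : Q `<=` B `|` (Q `&` ~` C).
    by move=> z Qz; rewrite BC; have [Cz|nCz] := pselect (C z); [left|right].
  have disj : B `&` (Q `&` ~` C) = set0.
    by rewrite -subset0 BC => z [[_ ?] []].
  have [Bx|] := pselect (B x).
    have QC0 := noSplit _ _ clB clQC QE disj Bx.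
    rewrite eqEsubset; split=> [z|z Qz]; first by rewrite BC => -[].
    have [//|nz] := QE z Qz.
    by have : (Q `&` (Q `&` ~` C)) z by []; rewrite QC0.
  rewrite BC => nBx.
  have QCx : (Q `&` ~` C) x by split=> // Cx; apply: nBx.
  rewrite setUC in QE; rewrite setIC in disj.
  have QB0 := noSplit _ _ clQC clB QE disj QCx.
  have : (Q `&` B) b by split=> //; move: Bb; rewrite BC => -[].
  by rewrite QB0.
have : connected_component [set: X] x y.
  by apply: (@connected_component_max _ _ Q x).
by rewrite tdX.
Qed.

Lemma profinite_clopen_nbhs {X : topologicalType} {x : X} {O : set X} :
  profinite X -> nbhs x O -> exists D, [/\ clopen D, D x & D `<=` O].
Proof.
move=> pX xO; have [cX hX _] := pX.
have := @zero_dimensional_cvg _ x hX (profinite_zero_dimensional pX) cX.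
by move=> /(_ O xO)[D [Dx cD] DO]; exists D.
Qed.

(** The fibers of [p] are a partition of [X] into clopen pieces, and the value
    of [p] on a piece indexes a neighborhood [O (p x)] containing that piece.
    The pieces come from a finite clopen cover made disjoint: [p x] is the first
    index in the list whose member of the cover contains [x]. *)
Lemma locally_constant_choice {X : topologicalType} (O : X -> set X) :
  profinite X -> (forall x, nbhs x (O x)) ->
  exists p : X -> X,
    (forall x, O (p x) x) /\ (forall x, \forall y \near x, p y = p x).
Proof.
move=> pX nO; have [cX _ _] := pX.
have /choice[B BP] x := profinite_clopen_nbhs pX (nO x).
have [|s sP] := compact_finite_cover B cX.
  by move=> x; have [[oB _] Bx _] := BP x; exact: open_nbhs_nbhs.
have hasB y : has (fun x => `[< B x y >]) s.
  by have [x xs Bxy] := sP y; apply/hasP; exists x => //; exact/asboolP.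
pose p y := nth y s (find (fun x => `[< B x y >]) s).
exists p; split=> [x|x].
  have [_ _] := BP (p x); apply; apply/asboolP.
  exact: (nth_find x (hasB x)).
have near_eq :
    \forall y \near x, {in s, forall z, `[< B z y >] = `[< B z x >]}.
  elim: (s) => [|z r IH]; first by apply: nearW.
  have [[oB cB] _ _] := BP z.
  have : \forall y \near x, `[< B z y >] = `[< B z x >].
    have [Bx|nBx] := pselect (B z x).
      apply: filterS (open_nbhs_nbhs (conj oB Bx)) => y By.
      by rewrite !asboolT.
    have oC : open_nbhs x (~` B z) by split=> //; exact: closed_openC.
    by apply: filterS (open_nbhs_nbhs oC) => y nBy; rewrite !asboolF.
  apply: filter_app; apply: filterS IH => y IH eqz u.
  by rewrite inE => /orP[/eqP->|/IH].
apply: filterS near_eq => y eqy; rewrite /p (eq_in_find eqy).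
by apply: set_nth_default; rewrite -has_find.
Qed.

Lemma locally_profinite_compact_open {T : topologicalType} (x : T) (O : set T) :
  locally_profinite T -> nbhs x O ->
  exists C, [/\ compact C, open C, C x & C `<=` O].
Proof.
move=> lT xO; have [N xN pN] := lT x; have [cN _ _] := pN.
have Nx : x \in N by apply: mem_set; exact: nbhs_singleton.
(* A subset of N which is open in N is open in T as soon as it stays in the
   interior of N. *)
have [|D [[oD cD] Dx DO]] := @profinite_clopen_nbhs _
    (exist _ x Nx : set_type N) (set_val @^-1` (O `&` N)°) pN.
  apply: open_nbhs_nbhs; split; last exact: filterI.
  by exists (O `&` N)° => //; exact: open_interior.
have sub : set_val @` D `<=` (O `&` N)° by move=> _ [z /DO ? <-].
exists (set_val @` D); split.
- apply: continuous_compact; last exact: subclosed_compact cD cN _.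
  by apply: continuous_subspaceT; exact: initial_continuous.
- case: (oD) => V oV VD.
  suff -> : set_val @` D = V `&` (O `&` N)°.
    by apply: openI => //; exact: open_interior.
  rewrite eqEsubset; split=> [z Dz|z [Vz Nz]].
    by split; [case: Dz => u Du <-; rewrite -VD in Du|exact: sub].
  have zN : z \in N by apply/mem_set; have [] := interior_subset Nz.
  by exists (exist _ z zN) => //; rewrite -VD.
- by exists (exist _ x Nx).
- by move=> z /sub/interior_subset[].
Qed.

(** * Groupoid identities *)

Lemma inv_unique {G : topGroupoid} {g h : arr G} :
  src g = tgt h -> mul g h = idarr (tgt g) -> h = inv g.
Proof.
move=> gh E; rewrite -[RHS]mul_idarr src_inv -E mul_assoc ?src_inv //.
by rewrite inv_mul gh idarr_mul.
Qed.

Lemma invK {G : topGroupoid} (g : arr G) : inv (inv g) = g.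
Proof. by apply/esym/inv_unique; rewrite ?src_inv // inv_mul tgt_inv. Qed.

Lemma idarr_idem {G : topGroupoid} (x : obj G) :
  mul (idarr x) (idarr x) = idarr x.
Proof. by rewrite -[X in mul _ (idarr X)](@src_idarr _ x) mul_idarr. Qed.

Lemma inv_idarr {G : topGroupoid} (x : obj G) : inv (idarr x) = idarr x.
Proof.
by apply/esym/inv_unique; rewrite ?src_idarr ?tgt_idarr // idarr_idem.
Qed.

Lemma inv_mul_rev {G : topGroupoid} {g h : arr G} :
  src g = tgt h -> inv (mul g h) = mul (inv h) (inv g).
Proof.
move=> gh; have hg : src (inv h) = tgt (inv g) by rewrite src_inv tgt_inv.
apply/esym/inv_unique; first by rewrite src_mul // tgt_mul // tgt_inv.
rewrite mul_assoc; last first.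
- by [].
- by rewrite src_mul // tgt_inv.
rewrite -(@mul_assoc _ g) ?tgt_inv // mul_inv -gh mul_idarr mul_inv.
by rewrite tgt_mul.
Qed.

Lemma near_mul {G : topGroupoid} {g h : arr G} {O : set (arr G)} :
  src g = tgt h -> nbhs (mul g h) O ->
  \forall g' \near g & h' \near h, src g' = tgt h' -> O (mul g' h').
Proof.
move=> gh ghO; have := @mul_continuous G (g, h) O ghO.
by rewrite nbhs_simpl /= /nbhs /= -nbhs_subspace_in.
Qed.

(** * The stabilizer of a set of arrows under right translation *)

Definition stabilizer {G : topGroupoid} (W : set (arr G)) : set (arr G) :=
  [set g | forall w, W w -> src w = tgt g -> W (mul w g)].

Lemma stabilizer_idarr {G : topGroupoid} (W : set (arr G)) (x : obj G) :
  stabilizer W (idarr x).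
Proof. by move=> w Ww; rewrite tgt_idarr => <-; rewrite mul_idarr. Qed.

Lemma stabilizer_mul {G : topGroupoid} {W : set (arr G)} {g h : arr G} :
  stabilizer W g -> stabilizer W h -> src g = tgt h -> stabilizer W (mul g h).
Proof.
move=> Mg Mh gh w Ww; rewrite tgt_mul // => wg.
by rewrite mul_assoc //; apply: Mh; [exact: Mg|rewrite src_mul].
Qed.

Lemma stabilizer_sub {G : topGroupoid} {W : set (arr G)} :
  range (@idarr G) `<=` W -> stabilizer W `<=` W.
Proof.
move=> W1 g Mg; rewrite -(idarr_mul g); apply: Mg; rewrite ?src_idarr //.
by apply: W1; exists (tgt g).
Qed.

Lemma stabilizer_units {G : topGroupoid} (W : set (arr G)) (x : obj G) :
  (stabilizer W `&` inv @^-1` stabilizer W) (idarr x).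
Proof. by split; rewrite /= ?inv_idarr; exact: stabilizer_idarr. Qed.

Lemma stabilizer_subgroupoid {G : topGroupoid} (W : set (arr G)) :
  subgroupoid (stabilizer W `&` inv @^-1` stabilizer W).
Proof.
have id1 := stabilizer_units W.
split=> // [g h [Mg Mg'] [Mh Mh'] gh|g [Mg Mg']].
- split; first exact: stabilizer_mul.
  rewrite /= inv_mul_rev //; apply: stabilizer_mul => //.
  by rewrite src_inv tgt_inv.
- by split; rewrite /= ?invK.
Qed.

(** The tube lemma: around [g] and each [w] of the compact set [W], either [w]
    and [g] are composable and nearby products stay in the open set [W], or they
    are not and, objects being separated, nearby pairs are not either. *)
Lemma stabilizer_open {G : topGroupoid} (W : set (arr G)) :
  hausdorff_space (obj G) -> open W -> compact W -> open (stabilizer W).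
Proof.
move=> hX oW cW; rewrite openE => g Mg.
have /compact_near_coveringP := cW.
apply=> w Ww.
have [wg|nwg] := pselect (src w = tgt g).
  have := near_mul wg (open_nbhs_nbhs (conj oW (Mg w Ww wg))).
  exact.
have : ~ cluster (nbhs (src w)) (tgt g) by move=> /hX.
move=> /existsNP[A /existsNP[B /not_implyP[Aw /not_implyP[Bg AB]]]].
exists (src @^-1` A, tgt @^-1` B).
  by split; [exact: src_continuous|exact: tgt_continuous].
case=> w' g' /= [Aw' Bg'] wg'; case: AB; exists (src w').
by split=> //; rewrite wg'.
Qed.

(** Let [w g] be outside [W].  As [W] is closed in [K], products near [w g]
    are outside [W] too; as the source map is open, every [g'] near [g] is
    composable with some [w'] of [W] near [w], and [w' g'] witnesses that [g']
    is not in the stabilizer. *)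
Lemma stabilizer_relatively_closed {G : topGroupoid} (W K : set (arr G)) :
  open_map (@src G) -> open W -> compact W -> hausdorff_on K -> W `<=` K ->
  (forall g h, W g -> W h -> src g = tgt h -> K (mul g h)) ->
  forall g, W g -> ~ stabilizer W g -> nbhs g (~` stabilizer W).
Proof.
move=> src_open oW cW hK WK WWK g Wg.
move=> /existsNP[w /not_implyP[Ww /not_implyP[wg nWwg]]].
have nW := compact_closed_in hK cW WK (WWK _ _ Ww Wg wg) nWwg.
have [[A B] /= [Aw Bg] AB] := near_mul wg nW.
have oA : open (src @` (A° `&` W)).
  by apply: src_open; apply: openI => //; exact: open_interior.
have sA : nbhs (tgt g) (src @` (A° `&` W)).
  by apply: open_nbhs_nbhs; split=> //; exists w => //; split.
have tA : \forall g' \near g, (src @` (A° `&` W)) (tgt g') :=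
  @tgt_continuous G g _ sA.
apply: filter_app tA; apply: filterS Bg => g' Bg' [w' [Aw' Ww'] wg'] Mg'.
apply: (AB (w', g')) => //=; last exact: Mg'.
by split=> //; exact: interior_subset.
Qed.

(** The stabilizer [M] is compact, being closed in [W].  For its intersection
    with its inverse, let [g] be in [M] with [inv g] outside [M]: as [inv g] is
    in [K], where the compact set [M] is closed, the inverses of arrows near
    [g] are outside [M]. *)
Lemma hausdorff_compact_open_stabilizer {G : topGroupoid} (W K : set (arr G)) :
  open_map (@src G) -> hausdorff_space (obj G) ->
  open W -> compact W -> range (@idarr G) `<=` W ->
  hausdorff_on K ->
  (forall g h, W g -> W h -> src g = tgt h -> K (mul g h)) ->
  (forall g, W g -> K (inv g)) ->
  hausdorff_compact_open_subgroupoid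
    (stabilizer W `&` inv @^-1` stabilizer W).
Proof.
move=> src_open hX oW cW W1 hK WWK WVK.
have WK : W `<=` K.
  move=> g Wg; rewrite -(mul_idarr g); apply: WWK; rewrite ?tgt_idarr //.
  by apply: W1; exists (src g).
have MW := stabilizer_sub W1.
have oM := stabilizer_open W hX oW cW.
have cM : compact (stabilizer W).
  apply: (compact_relatively_closed cW MW).
  exact: stabilizer_relatively_closed src_open oW cW hK WK WWK.
have MK := subset_trans MW WK.
split.
- exact: stabilizer_subgroupoid.
- by apply: openI => //; apply: open_comp oM => g _; exact: inv_continuous.
- apply: (compact_relatively_closed cM); first exact: subIsetl.
  move=> g Mg nHg; have nMg : ~ stabilizer W (inv g).
    by move=> Mg'; apply: nHg.
  have nM : \forall g' \near g, ~ stabilizer W (inv g') :=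
    @inv_continuous G g _ (compact_closed_in hK cM MK (WVK g (MW g Mg)) nMg).
  by apply: filterS nM => g' nMg' [].
- apply: hausdorff_on_set_type; apply: hausdorff_on_sub hK.
  by move=> g [/MK].
Qed.

(** * From neighborhoods of single units to neighborhoods of all units *)

Lemma unit_compact_open_nbhs {G : topGroupoid} (U : set (arr G)) (x : obj G) :
  locally_profinite (arr G) -> nbhs (idarr x) U ->
  exists CN : set (arr G) * set (arr G),
    [/\ [/\ compact CN.1, open CN.1, CN.1 (idarr x) & CN.1 `<=` U],
      hausdorff_on CN.2,
      forall g h, CN.1 g -> CN.1 h -> src g = tgt h -> CN.2 (mul g h)
      & forall g, CN.1 g -> CN.2 (inv g)].
Proof.
move=> lG xU; have [N xN [_ hN _]] := lG (idarr x).
have [||[A B] /= [Ax Bx] AB] := @near_mul G (idarr x) (idarr x) N°.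
- by rewrite src_idarr tgt_idarr.
- by rewrite idarr_idem; exact: nbhs_interior.
have invN : nbhs (idarr x) (inv @^-1` N°).
  by apply: inv_continuous; rewrite inv_idarr; exact: nbhs_interior.
have [C [cC oC Cx CO]] := locally_profinite_compact_open _ _ lG
  (filterI (filterI Ax Bx) (filterI xU invN)).
exists (C, N°); split=> //.
- by split=> // g /CO[_ []].
- exact: interior_hausdorff_on.
- by move=> g h /CO[[Ag _] _] /CO[[_ Bh] _]; exact: (AB (g, h)).
- by move=> g /CO[_ []].
Qed.

(** For a locally constant [p], its fibers partition the objects, and [glue p D]
    consists, over the various pieces, of the arrows with both ends in the piece
    and belonging to the member of [D] attached to it.  There is no arrow from
    one piece to another, hence no composition mixing two members of [D]. *)
Definition glue {G : topGroupoid} (p : obj G -> obj G)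
    (D : obj G -> set (arr G)) : set (arr G) :=
  [set g | p (src g) = p (tgt g) /\ D (p (src g)) g].

Lemma glue_open {G : topGroupoid} (p : obj G -> obj G)
    (D : obj G -> set (arr G)) :
  (forall x, \forall y \near x, p y = p x) ->
  (forall x, open (D x)) -> open (glue p D).
Proof.
move=> p_lc oD; rewrite openE => g [pg Dg].
have Ds : \forall h \near g, p (src h) = p (src g) :=
  @src_continuous G g _ (p_lc (src g)).
have Dt : \forall h \near g, p (tgt h) = p (tgt g) :=
  @tgt_continuous G g _ (p_lc (tgt g)).
have Dg' : nbhs g (D (p (src g))) by apply: open_nbhs_nbhs.
apply: filter_app Dg'; apply: filter_app Dt; apply: filterS Ds.
by move=> h /= sh th Dh; split; rewrite ?sh ?th.
Qed.

Lemma glue_compact {G : topGroupoid} (p : obj G -> obj G)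
    (D : obj G -> set (arr G)) :
  (forall x, \forall y \near x, p y = p x) ->
  compact [set: obj G] -> (forall x, compact (D x)) -> compact (glue p D).
Proof.
move=> p_lc cX cD; apply: (compact_preimage_local src _ cX) => x.
exists [set y | p y = p x]; first exact: p_lc.
have clp (f : arr G -> obj G) : continuous f -> closed [set g | p (f g) = p x].
  move=> cf g clg.
  by have [h [<- /= ->]] := clg _ (cf g _ (p_lc (f g))).
suff -> : glue p D `&` src @^-1` [set y | p y = p x] =
    D (p x) `&` ([set g | p (src g) = p x] `&` [set g | p (tgt g) = p x]).
  by apply: compact_closedI => //; apply: closedI; apply: clp;
    [exact: src_continuous|exact: tgt_continuous].
rewrite eqEsubset; split=> g.
  by move=> [[pg Dg] /= sg]; rewrite -pg -sg.
by move=> [Dg [/= sg tg]]; rewrite /glue /= tg sg.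
Qed.

(** Arrows with different sources are separated by them; two arrows with the
    same source belong to the same member of [D]. *)
Lemma glue_hausdorff {G : topGroupoid} (p : obj G -> obj G)
    (D : obj G -> set (arr G)) :
  hausdorff_space (obj G) -> (forall x, hausdorff_on (D x)) ->
  hausdorff_on (glue p D).
Proof.
move=> hX hD g h [pg Dg] [ph Dh] gh.
have sgh : src g = src h.
  by apply: hX; exact: cluster_continuous (@src_continuous G) gh.
by apply: (hD (p (src g))) => //; rewrite sgh.
Qed.

(** * Compact open subgroupoids near the units *)

Theorem theoremD (G : topGroupoid)
    (src_open : open_map (@src G)) (tgt_open : open_map (@tgt G))
    (arr_locally_profinite : locally_profinite (arr G))
    (obj_profinite : profinite (obj G))
    (U : set (arr G)) (U_open : open U)
    (U_units : range (@idarr G) `<=` U) :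
  exists H1 : set (arr G),
    [/\ hausdorff_compact_open_subgroupoid H1,
        range (@idarr G) `<=` H1
      & H1 `<=` U].
Proof.
have [cX hX _] := obj_profinite.
have /choice[CN CNP] (x : obj G) : exists CN : set (arr G) * set (arr G), _ :=
  unit_compact_open_nbhs U x arr_locally_profinite
    (open_nbhs_nbhs (conj U_open (U_units _ (imageT _ x)))).
pose C x := (CN x).1; pose N x := (CN x).2.
have [|p [pC p_lc]] :=
    locally_constant_choice (fun x => idarr @^-1` C x) obj_profinite.
  move=> x; apply: idarr_continuous; apply: open_nbhs_nbhs.
  by have [[]] := CNP x.
pose W := glue p C.
have W1 : range (@idarr G) `<=` W.
  by move=> _ [x _ <-]; split; rewrite ?src_idarr ?tgt_idarr //; exact: pC.
exists (stabilizer W `&` inv @^-1` stabilizer W); split.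
- apply: (@hausdorff_compact_open_stabilizer G W (glue p N)) => //.
  + by apply: glue_open => // x; have [[]] := CNP x.
  + by apply: glue_compact => // x; have [[]] := CNP x.
  + by apply: glue_hausdorff => // x; have [] := CNP x.
  + move=> g h [pg Cg] [ph Ch] gh.
    split; first by rewrite src_mul // tgt_mul // ph -gh.
    rewrite src_mul //; have [_ _ mulN _] := CNP (p (src h)).
    by apply: mulN => //; rewrite ph -gh.
  + move=> g [pg Cg]; split; rewrite src_inv ?tgt_inv // -pg.
    by have [_ _ _] := CNP (p (src g)); exact.
- by move=> _ [x _ <-]; exact: stabilizer_units.
- move=> g [/(stabilizer_sub W1)[_ Cg] _].
  by have [[_ _ _ CU] _ _ _] := CNP (p (src g)); exact: CU.
Qed.
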